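(* There exist absolute constants $c,c'>0$ such that the following holds for all integers $n\ge2$, $p\ge2$, all $q\in(0,1)$ with $nq\ge12\max(q,1-q)\log p$, and all $x^*\in\mathbb{R}_+^p$. With probability larger than $1-c'/p$, the weights $$d_k=\sqrt{6\log p}\left(\sqrt{\frac{3\log p}{2(n-1)^2q^2(1-q)^2}}+\sqrt{\frac{5\log p}{2(n-1)^2q^2(1-q)^2}+V_k^\top Y}\right)+\frac{\log p}{(n-1)q(1-q)}+c\left(\frac{3\log p}{n}+\frac{9\max(q^2,(1-q)^2)}{n^2q(1-q)}(\log p)^2\right)\hat N,$$ $k=1,\dots,p$, satisfy $$\big|(\tilde A^\top(\tilde Y-\tilde Ax^* ))_k\big|\le d_k\qquad\text{for all }k=1,\dots,p.$$ Moreover one can take $c=126$ as long as $n\ge20$.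
   Context: Model: $A=(a_{\ell,k})\in\{0,1\}^{n\times p}$ has i.i.d. Bernoulli($q$) entries, and conditionally on $A$ the entries $Y_1,\dots,Y_n$ of $Y$ are independent with $Y_\ell\sim\mathrm{Poisson}((Ax^* )_\ell)$. With $\mathbf 1_n,\mathbf 1_p$ the all-ones vectors of $\mathbb{R}^n,\mathbb{R}^p$, $$\tilde A=\frac{A-q\,\mathbf 1_n\mathbf 1_p^\top}{\sqrt{nq(1-q)}},\qquad \tilde Y=\frac{1}{(n-1)\sqrt{nq(1-q)}}\Big(nY-\Big(\sum_{\ell=1}^nY_\ell\Big)\mathbf 1_n\Big).$$ The vector $V_k\in\mathbb{R}^n$ has entries $$V_{k,\ell}=\left(\frac{na_{\ell,k}-\sum_{\ell'=1}^na_{\ell',k}}{n(n-1)q(1-q)}\right)^2,$$ and $$\hat N=\frac{1}{nq-\sqrt{6nq(1-q)\log p}-\max(q,1-q)\log p}\left(\sqrt{\frac{3\log p}{2}}+\sqrt{\frac{5\log p}{2}+\sum_{\ell=1}^nY_\ell}\right)^2 .$$ *)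

(* Defs.v *)
From HB Require Import structures.
From mathcomp Require Import all_boot all_order all_algebra.
From mathcomp Require Import all_classical all_reals all_analysis.

Set Implicit Arguments.
Unset Strict Implicit.
Unset Printing Implicit Defensive.

Import Order.TTheory GRing.Theory Num.Theory.
Import numFieldNormedType.Exports.

Local Open Scope classical_set_scope.
Local Open Scope ring_scope.

Section probabilistic_model.
Context (d : measure_display) (T : measurableType d) (R : realType).

(* Stated for a set function [mu], so that it applies both to a probability
   and to a conditional probability. *)
Definition mutually_independent (mu : set T -> \bar R)
    (d' : measure_display) (T' : measurableType d') (I : finType)
    (X : I -> T -> T') : Prop :=
  forall (J : {set I}) (B : I -> set T'), (forall i, measurable (B i)) ->
    mu (\bigcap_(i in [set i | i \in J]) (X i @^-1` B i)) =
    (\prod_(i in J) mu (X i @^-1` B i))%E.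

(* P(E | F); only meaningful when P F != 0. *)
Definition cond_prob (P : probability T R) (F E : set T) : \bar R :=
  (fine (P (E `&` F)) / fine (P F))%:E.

Context (P : probability T R) (n p : nat).

Definition design_mx (A : 'I_n -> 'I_p -> {RV P >-> bool}) (w : T) :
  'M[R]_(n, p) := \matrix_(l, k) (A l k w)%:R.

Definition obs_vec (Y : 'I_n -> {RV P >-> nat}) (w : T) : 'cV[R]_n :=
  \col_l (Y l w)%:R.

(* The matrix A takes finitely many values, so conditioning on A is elementary
   conditioning on the events {A = a} of positive probability. The last
   argument of [poisson_prob] before the set is a dummy; a Poisson law of
   rate 0 is the Dirac mass at 0. *)
Record bernoulli_poisson_model (q : R) (xstar : 'cV[R]_p)
    (A : 'I_n -> 'I_p -> {RV P >-> bool}) (Y : 'I_n -> {RV P >-> nat}) : Prop :=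
  BernoulliPoissonModel {
    design_bernoulli : forall l k (B : set bool),
      distribution P (A l k) B = bernoulli_prob q B;
    design_independent :
      mutually_independent P (fun lk : 'I_n * 'I_p => A lk.1 lk.2 : T -> bool);
    obs_poisson : forall a : 'M[R]_(n, p),
      P [set w | design_mx A w = a] != 0%E -> forall l (B : set nat),
      cond_prob P [set w | design_mx A w = a] (Y l @^-1` B) =
      poisson_prob ((a *m xstar) l 0) 0%N B;
    obs_independent : forall a : 'M[R]_(n, p),
      P [set w | design_mx A w = a] != 0%E ->
      mutually_independent (cond_prob P [set w | design_mx A w = a])
        (fun l => Y l : T -> nat)
  }.

End probabilistic_model.

Section weights.
Context (R : realType) (n p : nat) (q : R).
Implicit Types (A : 'M[R]_(n, p)) (Y : 'cV[R]_n).

Definition tildeA A : 'M[R]_(n, p) :=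
  (Num.sqrt (n%:R * q * (1 - q)))^-1 *:
    (A - q *: (const_mx 1 : 'cV[R]_n) *m (const_mx 1 : 'cV[R]_p)^T).

Definition tildeY Y : 'cV[R]_n :=
  ((n%:R - 1) * Num.sqrt (n%:R * q * (1 - q)))^-1 *:
    (n%:R *: Y - (\sum_l Y l 0) *: const_mx 1).

Definition Vvec A (k : 'I_p) : 'cV[R]_n :=
  \col_l ((n%:R * A l k - \sum_l' A l' k) /
          (n%:R * (n%:R - 1) * q * (1 - q))) ^+ 2.

Definition Nhat Y : R :=
  let logp := ln p%:R in
  (n%:R * q - Num.sqrt (6 * n%:R * q * (1 - q) * logp)
     - Num.max q (1 - q) * logp)^-1 *
  (Num.sqrt (3 * logp / 2) + Num.sqrt (5 * logp / 2 + \sum_l Y l 0)) ^+ 2.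

Definition weight (c : R) A Y (k : 'I_p) : R :=
  let logp := ln p%:R in
  Num.sqrt (6 * logp) *
    (Num.sqrt (3 * logp / (2 * (n%:R - 1) ^+ 2 * q ^+ 2 * (1 - q) ^+ 2)) +
     Num.sqrt (5 * logp / (2 * (n%:R - 1) ^+ 2 * q ^+ 2 * (1 - q) ^+ 2)
               + ((Vvec A k)^T *m Y) 0 0)) +
  logp / ((n%:R - 1) * q * (1 - q)) +
  c * (3 * logp / n%:R +
       9 * Num.max (q ^+ 2) ((1 - q) ^+ 2) / (n%:R ^+ 2 * q * (1 - q))
         * logp ^+ 2) * Nhat Y.

Definition weights_dominate (xstar : 'cV[R]_p) (c : R) A Y : Prop :=
  forall k : 'I_p,
    `| ((tildeA A)^T *m (tildeY Y - tildeA A *m xstar)) k 0 |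
      <= weight c A Y k.

End weights.

(* Main.v *)
Require Import Defs.
From HB Require Import structures.
From mathcomp Require Import all_boot all_order all_algebra.
From mathcomp Require Import all_classical all_reals all_analysis.
From mathcomp Require Import ring lra.

Set Implicit Arguments.
Unset Strict Implicit.
Unset Printing Implicit Defensive.

Import Order.TTheory GRing.Theory Num.Theory.
Import numFieldNormedType.Exports.

Local Open Scope classical_set_scope.
Local Open Scope ring_scope.

(** Write [lam = A x] for the intensities, [al l k = A l k - q] for the centred
design, [S k] for the sum over [l] of [al l k], and [u = 3 ln p].

Expanding the definitions splits the [k]-th coordinate of
[tildeA^T (tildeY - tildeA x)] into two sums
([estimating_equation_decomposition]):
- the sum over [l] of [r l * (Y l - lam l)], where the coefficients
  [r = contrast q A k] sum to zero and have [Vvec A k] as their squares;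
- the sum over [j] of [x j * G k j], where [G k j = cross_deviation q A k j] is
  the sum over [l] of [al l k * al l j], minus [S k * S j], divided by
  [(n - 1) n q (1 - q)].

Given the design, the first sum is a weighted sum of independent centred Poisson
variables, so Bernstein's inequality bounds it by [sqrt (2 v u) + b u / 3] with
[v] the sum of [r l ^+ 2 * lam l] and [b = 1 / ((n - 1) q (1 - q))].  The
variance [v] involves the unknown [x], but [Vvec^T Y] has conditional mean [v],
and Bernstein's inequality for it is a quadratic inequality in [sqrt v]; solving
it bounds [sqrt v] by the observable square roots of the first term of the
weight ([sqrt_intensity_le]).

The second sum needs no probability beyond the deviation of the [p] column sums
[S k], which Bernstein's inequality bounds by
[D = sqrt (6 n q (1 - q) ln p) + max (q, 1 - q) ln p].  Indeed, the entries being
0 or 1, [al ^+ 2 = q (1 - q) + (1 - 2 q) al], so the sum of the squares of a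
column of [al] is at most [n q (1 - q) + max (q, 1 - q) D]; sums of cross
products obey the same bound because [2 z w <= z ^+ 2 + w ^+ 2], and [S k * S j]
is at most [D ^+ 2].  Hence a uniform bound on [G] ([cross_deviation_le]), which
multiplies the sum of the [x j].  That sum is at most [Nhat]
([sum_xstar_le_Nhat]): the total intensity is the sum of the
[x j * (n q + S j)], hence at least [n q - D] times the sum of the [x j], while
the argument used for [v] bounds its square root by means of the total count.

Altogether [2 p] deviations of column sums, [2 p + p] of weighted Poisson sums
and one of the total count have to be excluded, each of probability at most
[expR (- u) = p ^- 3], and [(5 p + 1) / p ^+ 3 < 7 / p].

Bernstein's inequality is proved by Chernoff's method over finitely many
outcomes, so that moment generating functions are finite sums: the design is
finite, and the Poisson counts are truncated at a level that then tends to
infinity. *)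

(** * The exponential function and quadratic bounds *)

Section exponential.
Context {R : realType}.
Implicit Types x y : R.

Lemma series_exp_coeff_le_expR x n : 0 <= x -> series (exp_coeff x) n <= expR x.
Proof.
move=> x0; apply: nondecreasing_cvgn_le; last exact: is_cvg_series_exp_coeff.
apply/nondecreasing_seqP => k; rewrite /series/= big_nat_recr//= lerDl.
by rewrite /exp_coeff divr_ge0// exprn_ge0.
Qed.

Lemma expR_ge_quadratic x : 0 <= x -> 1 + x + x ^+ 2 / 2 <= expR x.
Proof.
move=> /series_exp_coeff_le_expR-/(_ 3%N).
rewrite /series/= /exp_coeff/= !big_nat_recr//= big_geq// !factS fact0.
rewrite muln1 add0r expr0 expr1 !divr1; exact.
Qed.

(** The factorials dominate a geometric sequence of ratio 3: this is where the
condition [x < 3] and the factor [1 - x / 3] of Bernstein's inequality come from. *)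
Lemma fact_ge_geometric n : (2 * 3 ^ n <= n.+2`!)%N.
Proof.
elim: n => [|n IH]//; rewrite expnS mulnCA factS.
by rewrite (leq_trans (leq_mul (leqnn 3) IH))// leq_mul2r orbT.
Qed.

(** The exponential series is dominated term by term, from degree 2 on, by a
geometric series of ratio [x / 3]. *)
Lemma expR_le_quadratic_pos x : 0 <= x < 3 ->
  expR x <= 1 + x + x ^+ 2 / (2 * (1 - x / 3)).
Proof.
move=> /andP[x0 x3]; have d0 : 0 < 1 - x / 3 by lra.
have part n : series (exp_coeff x) n.+2 <=
    1 + x + x ^+ 2 / (2 * (1 - x / 3)) * (1 - (x / 3) ^+ n).
  elim: n => [|n IH].
    rewrite /series/= /exp_coeff/= !big_nat_recr//= big_geq// !expr0.
    by rewrite subrr mulr0 expr1 !divr1 add0r addr0.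
  rewrite /series/= big_nat_recr//=.
  have -> : 1 + x + x ^+ 2 / (2 * (1 - x / 3)) * (1 - (x / 3) ^+ n.+1) =
    1 + x + x ^+ 2 / (2 * (1 - x / 3)) * (1 - (x / 3) ^+ n) +
    x ^+ n.+2 / (2 * 3 ^+ n).
    rewrite !exprS !exprMn exprVn; field.
    by rewrite expf_neq0//=; lra.
  apply: lerD => //; rewrite /exp_coeff ler_wpM2l// ?exprn_ge0//.
  rewrite lef_pV2 ?posrE ?mulr_gt0// ?ltr0n ?fact_gt0 ?exprn_gt0//.
  by rewrite -natrX -natrM ler_nat fact_ge_geometric.
apply: limr_le; first exact: is_cvg_series_exp_coeff.
near=> n; have n2 : (2 <= n)%N by near: n; exact: nbhs_infty_ge.
rewrite -(subnK n2) addn2 (le_trans (part _))// lerD2l ler_piMr//.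
  by rewrite divr_ge0 ?sqr_ge0// mulr_ge0// ltW.
by rewrite lerBlDr lerDl exprn_ge0// divr_ge0.
Unshelve. all: by end_near. Qed.

(** With [z = - x], the product [(1 + z + z ^+ 2 / 2) (1 - z + z ^+ 2 / 2)] is
[1 + z ^+ 4 / 4], so the second factor is at least [expR (- z)]. *)
Lemma expR_le_quadratic_neg x : x <= 0 -> expR x <= 1 + x + x ^+ 2 / 2.
Proof.
move=> x0; have y0 : 0 <= - x by rewrite oppr_ge0.
have h := expR_ge_quadratic y0; rewrite -[X in expR X <= _]opprK expRN.
have h0 : 0 < 1 - x + (- x) ^+ 2 / 2 by nra.
apply: (@le_trans _ _ (1 - x + (- x) ^+ 2 / 2)^-1).
  by rewrite lef_pV2 ?posrE ?expR_gt0.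
rewrite -div1r ler_pdivrMr//.
rewrite [leRHS](_ : _ = 1 + (x ^+ 2) ^+ 2 / 4); last by field.
by rewrite lerDl divr_ge0// sqr_ge0.
Qed.

(** The pointwise inequality behind Bernstein's bound: for a centred variable below
[y], taking expectations leaves only the variance term. *)
Lemma expR_le_bernstein x y : x <= y -> 0 <= y < 3 ->
  expR x <= 1 + x + x ^+ 2 / (2 * (1 - y / 3)).
Proof.
move=> xy /andP[y0 y3]; have [x0|x0] := leP x 0.
  apply: (le_trans (expR_le_quadratic_neg x0)).
  by rewrite lerD2l ler_wpM2l ?sqr_ge0// lef_pV2 ?posrE; lra.
apply: (le_trans (@expR_le_quadratic_pos x _)); first by apply/andP; split; lra.
by rewrite lerD2l ler_wpM2l ?sqr_ge0// lef_pV2 ?posrE; lra.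
Qed.

End exponential.

(** * Chernoff and Bernstein bounds on finitely many outcomes *)

Section chernoff.
Context {d : measure_display} {T : measurableType d} {R : realType}.
Implicit Types (mu : {measure set T -> \bar R}) (E F : set T).

Lemma measure_le_sum_cover mu (J : finType) E (B : J -> set T) :
  measurable E -> (forall j, measurable (B j)) -> E `<=` \bigcup_j B j ->
  (mu E <= \sum_j mu (B j))%E.
Proof.
move=> mE mB EB.
have Jfin : finite_set [set: J] by exact: finite_finset.
have := @content_sub_fsum _ _ _ mu J setT E B Jfin (fun i _ => mB i) mE EB.
move=> /le_trans; apply; rewrite (fsbigE (index_enum J)) ?index_enum_uniq//.
- by under eq_bigl do rewrite in_setT.
- by move=> j _; rewrite mem_index_enum.
Qed.

(** Chernoff's bound for an event on which the variables take values in the image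
of the finite type [K].  The cells where all the variables are prescribed need only
have a mass at most [p0] times a product: with [F] an event of probability [p0]
this covers independence conditionally on [F], while arbitrary
nonnegative weights [pr] cover truncated laws. *)
Lemma chernoff_grid mu (I K : finType) (T' : Type) (X : I -> T -> T')
    (h : K -> T') (g : I -> T' -> R) (pr : I -> K -> R) (F E : set T)
    (p0 theta t : R) :
  let cell y := F `&` [set x | forall i, X i x = h (y i)] in
  (forall y : {ffun I -> K}, measurable (cell y)) ->
  (forall y : {ffun I -> K}, (mu (cell y) <= (p0 * \prod_i pr i (y i))%:E)%E) ->
  0 <= p0 -> (forall i k, 0 <= pr i k) -> 0 <= theta ->
  measurable E ->
  (forall x, E x -> [/\ F x, forall i, exists k, X i x = h k &
                        t <= \sum_i g i (X i x)]) ->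
  (mu E <= (p0 * expR (- (theta * t)) *
           \prod_i \sum_k pr i k * expR (theta * g i (h k)))%:E)%E.
Proof.
move=> cell mcell cellE p0_ge0 pr_ge0 theta0 mE EP.
pose D (y : {ffun I -> K}) := t <= \sum_i g i (h (y i)).
pose B y := if D y then cell y else set0.
have mB y : measurable (B y) by rewrite /B; case: ifP.
have EB : E `<=` \bigcup_y B y.
  move=> x /EP[Fx Xh tx].
  pose y := [ffun i => projT1 (cid (Xh i))].
  have yE i : X i x = h (y i) by rewrite ffunE; case: cid.
  exists y => //; rewrite /B /D.
  by under eq_bigr do rewrite -yE; rewrite tx; split.
apply: (le_trans (measure_le_sum_cover mu mE mB EB)).
rewrite bigA_distr_bigA mulr_sumr -sumEFin; apply: lee_sum => y _.
rewrite /B; case: ifPn => [Dy|_]; last first.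
  rewrite measure0 lee_fin !mulr_ge0 ?expR_ge0//.
  by rewrite prodr_ge0// => i _; rewrite mulr_ge0 ?expR_ge0.
apply: (le_trans (cellE y)); rewrite lee_fin big_split/= -mulrA ler_wpM2l//.
rewrite mulrCA ler_peMr//; first by rewrite prodr_ge0.
rewrite -expR_sum -expRD -expR0 ler_expR -mulr_sumr addrC -mulrBr.
by rewrite mulr_ge0// subr_ge0.
Qed.

End chernoff.

Section bernstein.
Context {R : realType}.
Implicit Types (v b u theta : R).

(** Deviation exceeded with probability at most [expR (- u)] by a sum of variance
[v] whose terms are bounded by [b]. *)
Definition bernstein_radius v b u : R := Num.sqrt (2 * v * u) + b * u / 3.

(** The optimal parameter is [tau / (1 + c tau)] with [tau = sqrt (2 u / v)] and
[c = b / 3], for which the exponent is exactly [- u].  When [v = 0] the bound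
is instead the limit as [theta * b] tends to 3. *)
Lemma bernstein_optimisation (z p0 v b u : R) :
  0 <= z -> 0 <= p0 -> 0 <= v -> 0 < b -> 0 <= u ->
  (forall theta, 0 <= theta -> theta * b < 3 ->
     z <= p0 * expR (v * theta ^+ 2 / (2 * (1 - theta * b / 3)) -
                     theta * bernstein_radius v b u)) ->
  z <= p0 * expR (- u).
Proof.
move=> z0 p00; rewrite le_eqVlt => /orP[/eqP<- b0 u0 H|v0 b0 u0 H].
  have {}H x : 0 <= x < 1 -> z <= p0 * expR (- (x * u)).
    move=> /andP[x0 x1]; have := H (x * 3 / b).
    rewrite divfK ?gt_eqF// => /(_ _ _)/le_trans; apply.
    - by rewrite divr_ge0 ?mulr_ge0// ltW.
    - by rewrite gtr_pMl.
    - rewrite /bernstein_radius mulr0 !mul0r sqrtr0 !add0r.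
      have -> : x * 3 / b * (b * u / 3) = x * u by field; rewrite gt_eqF.
      exact: lexx.
  (* [D] is the distance of [theta * b / 3] to its limit 1, small enough for the
     loss [D * z * u] to be below [e] *)
  apply/ler_addgt0Pr => e e0.
  pose D := Num.min 1 (e / (z * u + 1)).
  have zu0 : 0 < z * u + 1 by rewrite ltr_wpDl// mulr_ge0.
  have D0 : 0 < D by rewrite lt_min ltr01 divr_gt0.
  have D1 : D <= 1 by rewrite ge_min lexx.
  have De : D * (z * u + 1) <= e by rewrite -ler_pdivlMr// ge_min lexx orbT.
  have /H zx : 0 <= 1 - D < 1 by apply/andP; split; lra.
  have : z * expR (- (D * u)) <= p0 * expR (- u).
    rewrite -(ler_pM2r (expR_gt0 (- (D * u)))) in zx.
    apply: (le_trans zx); rewrite -mulrA -expRD ler_wpM2l// ler_expR; lra.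
  have := expR_ge1Dx (- (D * u)).
  move: (expR _) => E1; nra.
pose tau := Num.sqrt (2 * u / v); pose c := b / 3.
have tau0 : 0 <= tau by exact: sqrtr_ge0.
have tau2 : tau ^+ 2 = 2 * u / v by rewrite sqr_sqrtr// divr_ge0 ?mulr_ge0// ltW.
have c0 : 0 < c by rewrite divr_gt0.
have ct0 : 0 < 1 + c * tau by rewrite ltr_wpDr// mulr_ge0// ltW.
have sE : Num.sqrt (2 * v * u) = v * tau.
  have -> : 2 * v * u = (v * tau) ^+ 2.
    by rewrite exprMn tau2; field; rewrite gt_eqF.
  by rewrite sqrtr_sqr ger0_norm// mulr_ge0// ltW.
have bE : b = 3 * c by rewrite /c; field.
have uE : u = v * tau ^+ 2 / 2 by rewrite tau2; field; rewrite gt_eqF.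
have ctN : 1 + c * tau != 0 by rewrite gt_eqF.
apply: (le_trans (H (tau / (1 + c * tau)) _ _)).
- by rewrite divr_ge0// ltW.
- by rewrite mulrAC ltr_pdivrMr// bE; lra.
rewrite ler_wpM2l// ler_expR /bernstein_radius sE.
rewrite le_eqVlt; apply/orP; left; apply/eqP.
clearbody c tau; rewrite bE uE.
field; rewrite ctN [tau * c]mulrC addrK oner_neq0//.
Qed.

(** The hypothesis on the moment generating functions is what [expR_le_bernstein]
gives for centred variables bounded by [b], of variance [v i]. *)
Lemma bernstein_grid (d : measure_display) (T : measurableType d)
    (mu : {measure set T -> \bar R}) (I K : finType) (T' : Type)
    (X : I -> T -> T') (h : K -> T') (g : I -> T' -> R) (pr : I -> K -> R)
    (F E : set T) (p0 V b u : R) (v : I -> R) :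
  let cell y := F `&` [set x | forall i, X i x = h (y i)] in
  (forall y : {ffun I -> K}, measurable (cell y)) ->
  (forall y : {ffun I -> K}, (mu (cell y) <= (p0 * \prod_i pr i (y i))%:E)%E) ->
  0 <= p0 -> (forall i k, 0 <= pr i k) -> 0 < b -> 0 <= u ->
  0 <= V -> \sum_i v i <= V ->
  (forall theta, 0 <= theta -> theta * b < 3 -> forall i,
     \sum_k pr i k * expR (theta * g i (h k)) <=
     expR (v i * theta ^+ 2 / (2 * (1 - theta * b / 3)))) ->
  measurable E ->
  (forall x, E x -> [/\ F x, forall i, exists k, X i x = h k &
                        bernstein_radius V b u <= \sum_i g i (X i x)]) ->
  (mu E <= (p0 * expR (- u))%:E)%E.
Proof.
move=> cell mcell cellE p0_ge0 pr_ge0 b0 u0 V0 vV mgf mE EP.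
have chern theta (theta0 : 0 <= theta) :=
  @chernoff_grid _ _ _ mu I K T' X h g pr F E p0 theta _ mcell cellE p0_ge0
    pr_ge0 theta0 mE EP.
(* the bound at [theta = 0] shows that the mass is finite *)
have muE : mu E = (fine (mu E))%:E.
  rewrite fineK// ge0_fin_numE ?measure_ge0//.
  exact: le_lt_trans (chern 0 (lexx 0)) (ltry _).
rewrite muE lee_fin.
apply: (@bernstein_optimisation _ _ V b) => //.
move=> theta theta0 thetab; rewrite -lee_fin -muE.
apply: (le_trans (chern theta theta0)); rewrite lee_fin -mulrA ler_wpM2l//.
rewrite addrC expRD ler_wpM2l ?expR_ge0//.
have d0 : 0 < 1 - theta * b / 3 by rewrite subr_gt0 ltr_pdivrMr// mul1r.
apply: (@le_trans _ _
    (\prod_i expR (v i * theta ^+ 2 / (2 * (1 - theta * b / 3))))).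
  apply: ler_prod => i _; rewrite mgf// andbT.
  by apply: sumr_ge0 => k _; rewrite mulr_ge0 ?expR_ge0.
rewrite -expR_sum ler_expR -!mulr_suml -mulrA -[leRHS]mulrA ler_wpM2r//.
by rewrite divr_ge0 ?sqr_ge0// mulr_ge0// ltW.
Qed.

End bernstein.

(** * Measurability, conditioning on a discrete variable, union bound *)

Section measurability.
Context {d : measure_display} {T : measurableType d} {R : realType}.

Lemma measurable_forall_fin (I : finType) (E : I -> set T) :
  (forall i, measurable (E i)) -> measurable [set w | forall i, E i w].
Proof.
move=> mE; have -> : [set w | forall i, E i w] = ~` \bigcup_i ~` E i.
  rewrite setC_bigcup; under eq_bigcapr do rewrite setCK.
  by apply/seteqP; split=> w /= Ew i; [move=> _|]; exact: Ew.
apply/measurableC/countable_bigcupT_measurable => [|i].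
  exact/finite_set_countable/finite_finset.
exact/measurableC.
Qed.

Lemma measurable_constant_prop (C : Prop) : measurable [set _ : T | C].
Proof.
have [c|nc] := pselect C.
  by rewrite [X in measurable X](_ : _ = setT)//; apply/seteqP; split.
by rewrite [X in measurable X](_ : _ = set0)//; apply/seteqP; split.
Qed.

Context {P : probability T R} {n p : nat}.
Context (A : 'I_n -> 'I_p -> {RV P >-> bool}) (Y : 'I_n -> {RV P >-> nat}).

Definition bool_mx (w : T) : 'M[bool]_(n, p) := \matrix_(l, k) A l k w.

Lemma design_mxE w : design_mx A w = map_mx (fun b : bool => b%:R) (bool_mx w).
Proof. by apply/matrixP => l k; rewrite !mxE. Qed.

Lemma measurable_bool_mx (b : 'M[bool]_(n, p)) :
  measurable [set w | bool_mx w = b].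
Proof.
have -> : [set w | bool_mx w = b] =
    [set w | forall lk : 'I_n * 'I_p, (A lk.1 lk.2 @^-1` [set b lk.1 lk.2]) w].
  apply/seteqP; split=> [w <- [l k]/=|w /= Ab]; first by rewrite mxE.
  by apply/matrixP => l k; rewrite mxE; exact: (Ab (l, k)).
by apply: measurable_forall_fin => lk; exact: measurable_funPTI.
Qed.

Lemma measurable_obs (y : 'I_n -> nat) : measurable [set w | forall l, Y l w = y l].
Proof.
apply: (@measurable_forall_fin _ (fun l => Y l @^-1` [set y l])) => l.
exact: measurable_funPTI.
Qed.

(** Both the design and the observations take countably many values, so that any
predicate on them, measurable or not, defines an event. *)
Lemma measurable_model_event (Q : 'M[R]_(n, p) -> 'cV[R]_n -> Prop) :
  measurable [set w | Q (design_mx A w) (obs_vec Y w)].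
Proof.
pose cell (c : 'M[bool]_(n, p) * {ffun 'I_n -> nat}) :=
  [set w | bool_mx w = c.1] `&` [set w | forall l, Y l w = c.2 l] `&`
  [set w | Q (map_mx (fun b : bool => b%:R) c.1) (\col_l (c.2 l)%:R)].
have -> : [set w | Q (design_mx A w) (obs_vec Y w)] = \bigcup_c cell c.
  apply/seteqP; split=> [w /= Qw|w [[b y] _ [[/= bE yE] Qby]]].
    exists (bool_mx w, [ffun l => Y l w]) => //; split=> /=.
      by split=> // l; rewrite ffunE.
    rewrite -design_mxE; congr (Q _ _): Qw.
    by apply/matrixP => l i; rewrite !mxE ffunE.
  rewrite design_mxE bE; congr (Q _ _): Qby.
  by apply/matrixP => l i; rewrite !mxE yE.
apply: countable_bigcupT_measurable => [|[b y]].
  exact: countableP.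
apply: measurableI.
  by apply: measurableI; [exact: measurable_bool_mx|exact: measurable_obs].
exact: measurable_constant_prop.
Qed.

End measurability.

Section conditioning.
Context {d : measure_display} {T : measurableType d} {R : realType}.
Context (P : probability T R).

Lemma sum_measure_fibers (J : finType) (Z : T -> J) :
  (forall j, measurable (Z @^-1` [set j])) ->
  (\sum_j P (Z @^-1` [set j]) = 1)%E.
Proof.
move=> mZ.
have Jfin : finite_set [set: J] by exact: finite_finset.
have tZ : trivIset setT (fun j => Z @^-1` [set j]) by exact: trivIset_preimage1.
have := measure_fin_bigcup P Jfin tZ (fun j _ => mZ j).
rewrite (fsbigE (index_enum J)) ?index_enum_uniq//; last first.
  by move=> j _; rewrite mem_index_enum.
under eq_bigl do rewrite in_setT; move=> <-.
rewrite -(probability_setT P); congr (P _).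
by apply/seteqP; split=> // w _; exists (Z w).
Qed.

(** How a conditional tail bound becomes unconditional.  It is stated without division,
so that it makes sense on fibers of probability zero. *)
Lemma le_measure_of_fibers (J : finType) (Z : T -> J) (E : set T) (e : R) :
  (forall j, measurable (Z @^-1` [set j])) -> measurable E ->
  (forall j, (P (Z @^-1` [set j] `&` E) <= P (Z @^-1` [set j]) * e%:E)%E) ->
  (P E <= e%:E)%E.
Proof.
move=> mZ mE H.
have mZE j : measurable (Z @^-1` [set j] `&` E) by exact: measurableI.
have := @measure_le_sum_cover _ _ _ P J E (fun j => Z @^-1` [set j] `&` E) mE mZE.
move=> /(_ _)/le_trans; apply; first by move=> w Ew; exists (Z w).
apply: (@le_trans _ _ (\sum_j (P (Z @^-1` [set j]) * e%:E))%E).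
  by apply: lee_sum => j _; exact: H.
rewrite -ge0_sume_distrl//.
by rewrite sum_measure_fibers// mul1e.
Qed.

Lemma union_bound_compl (J : finType) (G : set T) (B : J -> set T) (e : R) :
  measurable G -> (forall j, measurable (B j)) ->
  (forall j, (P (B j) <= e%:E)%E) -> (forall w, (forall j, ~ B j w) -> G w) ->
  ((1 - #|J|%:R * e)%:E <= P G)%E.
Proof.
move=> mG mB Be BG.
have mGC := measurableC mG.
have : (P (~` G) <= (#|J|%:R * e)%:E)%E.
  apply: (le_trans (measure_le_sum_cover P mGC mB _)).
    by move=> w Gw; apply: contrapT => nB; apply/Gw/BG => j Bj; apply: nB; exists j.
  rewrite mulr_natl -sumr_const -sumEFin; apply: lee_sum => j _; exact: Be.
rewrite probability_setC//.
have : P G \is a fin_num by exact: fin_num_measure.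
by case: (P G) => // r _; rewrite -EFinB !lee_fin; lra.
Qed.

End conditioning.

(** * Moment generating functions of the Bernoulli and Poisson laws *)

Section moment_generating_functions.
Context {R : realType}.
Implicit Types (q lam r b theta : R).

(** A sign [eps] gives both tails at once. *)
Lemma bernoulli_mgf q eps theta : 0 < q < 1 -> `|eps| = 1 ->
  0 <= theta -> theta * Num.max q (1 - q) < 3 ->
  \sum_(k : bool) bernoulli_pmf q k * expR (theta * (eps * (k%:R - q))) <=
  expR (q * (1 - q) * theta ^+ 2 /
        (2 * (1 - theta * Num.max q (1 - q) / 3))).
Proof.
move=> /andP[q0 q1] eps1 theta0; set M := Num.max _ _ => thetaM.
have qM : q <= M by rewrite le_max lexx.
have qM' : 1 - q <= M by rewrite le_max lexx orbT.
have eps2 : eps ^+ 2 = 1 by rewrite -real_normK ?num_real// eps1 expr1n.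
have bnd (k : bool) : theta * (eps * (k%:R - q)) <= theta * M.
  rewrite ler_wpM2l// (le_trans (ler_norm _))// normrM eps1 mul1r.
  by rewrite ler_norml; case: k => /=; apply/andP; split; lra.
have tM : 0 <= theta * M < 3 by rewrite thetaM mulr_ge0//; lra.
have e1 := expR_le_bernstein (bnd true) tM.
have e0 := expR_le_bernstein (bnd false) tM.
rewrite big_bool /bernoulli_pmf/=.
set D := 2 * (1 - theta * M / 3) in e1 e0 *.
apply: (@le_trans _ _ (1 + q * (1 - q) * theta ^+ 2 / D)); last first.
  exact: expR_ge1Dx.
apply: (@le_trans _ _
  (q * (1 + theta * (eps * (1 - q)) + (theta * (eps * (1 - q))) ^+ 2 / D) +
   (1 - q) * (1 + theta * (eps * (0 - q)) + (theta * (eps * (0 - q))) ^+ 2 / D))).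
  by apply: lerD; rewrite ler_wpM2l//; lra.
rewrite !exprMn eps2 le_eqVlt; apply/orP; left; apply/eqP.
by move: D^-1 => D'; ring.
Qed.

(** For rate 0 the usual formula still holds, because [0 ^+ 0 = 1]; this spares a case
distinction on vanishing intensities. *)
Lemma poisson_prob_set1 lam k : 0 <= lam ->
  poisson_prob lam 0 [set k] = (lam ^+ k / k`!%:R * expR (- lam))%:E.
Proof.
rewrite le_eqVlt /poisson_prob => /orP[/eqP<-|lam0].
  rewrite ltxx oppr0 expR0 mulr1 diracE.
  case: k => [|k]; rewrite expr0n/= ?mul0r; last by rewrite memNset.
  by rewrite mem_set ?divr1.
rewrite lam0 esum_set1 ?lee_fin ?poisson_pmf_ge0//.
by rewrite /poisson_pmf lam0.
Qed.

(** The truncated moment generating function is at most the full one,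
[expR (lam * (expR (theta * r) - 1 - theta * r))]. *)
Lemma poisson_mgf lam r b theta N : 0 <= lam -> `|r| <= b ->
  0 <= theta -> theta * b < 3 ->
  \sum_(k < N) lam ^+ k / k`!%:R * expR (- lam) *
               expR (theta * (r * (k%:R - lam))) <=
  expR (r ^+ 2 * lam * theta ^+ 2 / (2 * (1 - theta * b / 3))).
Proof.
move=> lam0 rb theta0 thetab.
have tb : 0 <= theta * b < 3.
  by rewrite thetab mulr_ge0// (le_trans _ rb).
have bnd : theta * r <= theta * b.
  by rewrite ler_wpM2l// (le_trans (ler_norm _)).
have /(ler_wpM2l lam0) H := expR_le_bernstein bnd tb.
have -> : \sum_(k < N) lam ^+ k / k`!%:R * expR (- lam) *
               expR (theta * (r * (k%:R - lam))) =
    expR (- lam - theta * r * lam) *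
    series (exp_coeff (lam * expR (theta * r))) N.
  rewrite /series/= big_mkord mulr_sumr; apply: eq_bigr => k _.
  have -> : theta * (r * (k%:R - lam)) = theta * r * k%:R - theta * r * lam.
    by ring.
  rewrite /exp_coeff/= exprMn -expRM_natr !expRD.
  by move: k`!%:R^-1 => f; ring.
apply: (@le_trans _ _ (expR (- lam - theta * r * lam) *
                       expR (lam * expR (theta * r)))).
  rewrite ler_wpM2l ?expR_ge0//; apply: series_exp_coeff_le_expR.
  by rewrite mulr_ge0 ?expR_ge0.
rewrite -expRD ler_expR (le_trans (lerD (lexx _) H))//.
rewrite le_eqVlt; apply/orP; left; apply/eqP.
by move: (_ ^-1) => D'; ring.
Qed.

End moment_generating_functions.

(** * Deviations in the Bernoulli-Poisson model *)

Section deviations.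
Context {d : measure_display} {T : measurableType d} {R : realType}.
Context (P : probability T R) (n p : nat) (q : R) (xstar : 'cV[R]_p).
Context (A : 'I_n -> 'I_p -> {RV P >-> bool}) (Y : 'I_n -> {RV P >-> nat}).
Hypothesis q01 : 0 < q < 1.
Hypothesis model : bernoulli_poisson_model q xstar A Y.

Lemma design_column_law k (y : 'I_n -> bool) :
  P [set w | forall l, A l k w = y l] = (\prod_l bernoulli_pmf q (y l))%:E.
Proof.
pose J := [set lk : 'I_n * 'I_p | lk.2 == k]%SET.
have := design_independent model J (B := fun lk => [set y lk.1]) (fun _ => I).
have -> : \bigcap_(i in [set i | i \in J])
      ((A i.1 i.2 : T -> bool) @^-1` [set y i.1]) =
    [set w | forall l, A l k w = y l].
  apply/seteqP; split=> [w Aw l|w Aw [l k'] /=].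
    by apply: (Aw (l, k)); rewrite /= inE.
  by rewrite inE => /eqP/= ->; exact: Aw.
move=> ->; rewrite -prodEFin.
rewrite (reindex_onto (fun l => (l, k)) fst)/=; last first.
  by move=> [l k'] /=; rewrite inE => /eqP/= ->.
apply: eq_big => [l|l _]; first by rewrite inE !eqxx.
have := design_bernoulli model l k [set y l].
rewrite /distribution/pushforward/= => ->.
rewrite /bernoulli_prob fsbig_set1 ifT//.
by case/andP: q01 => q0 q1; rewrite !ltW.
Qed.

Definition column_deviation (M : 'M[R]_(n, p)) k : R := \sum_l (M l k - q).

Lemma column_deviation_tail k eps u : `|eps| = 1 -> 0 <= u ->
  (P [set w | bernstein_radius (n%:R * (q * (1 - q))) (Num.max q (1 - q)) u <=
              eps * column_deviation (design_mx A w) k]%R <= (expR (- u))%:E)%E.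
Proof.
move=> eps1 u0; have /andP[q0 q1] := q01.
rewrite -[expR (- u)]mul1r.
apply: (@bernstein_grid _ _ _ P 'I_n bool bool (fun l => A l k) id
  (fun _ b => eps * (b%:R - q)) (fun _ b => bernoulli_pmf q b) setT
  _ 1 (n%:R * (q * (1 - q))) (Num.max q (1 - q)) u (fun _ => q * (1 - q))) => //.
- move=> y; rewrite setTI.
  apply: (@measurable_forall_fin _ _ _ (fun l => A l k @^-1` [set y l])) => l.
  exact: measurable_funPTI.
- by move=> y; have := design_column_law k y; rewrite setTI mul1r => /= ->.
- by move=> _ b; rewrite bernoulli_pmf_ge0// !ltW.
- by rewrite lt_max q0.
- by rewrite !mulr_ge0// ?subr_ge0 ltW.
- by rewrite sumr_const card_ord mulr_natl.
- by move=> theta theta0 thetaM _; apply: bernoulli_mgf.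
- exact: (measurable_model_event A Y (fun a _ => bernstein_radius
    (n%:R * (q * (1 - q))) (Num.max q (1 - q)) u <= eps * column_deviation a k)).
- move=> w /= Dw; split=> // [l|]; first by exists (A l k w).
  by move: Dw; rewrite -mulr_sumr /column_deviation; under eq_bigr do rewrite mxE.
Qed.

(** The product form of the law of the counts given the design, restated as a joint
probability so as to be used as a family of cells in Bernstein's bound. *)
Lemma conditional_obs_law (a : 'M[R]_(n, p)) (y : 'I_n -> nat) :
  (forall l, 0 <= (a *m xstar) l 0) ->
  P [set w | design_mx A w = a] != 0%E ->
  P ([set w | design_mx A w = a] `&` [set w | forall l, Y l w = y l]) =
  (fine (P [set w | design_mx A w = a]) *
   \prod_l ((a *m xstar) l 0 ^+ y l / (y l)`!%:R * expR (- (a *m xstar) l 0)))%:E.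
Proof.
move=> lam0 Pa0.
have := obs_independent model Pa0 [set: 'I_n]%SET (B := fun l => [set y l])
  (fun _ => I).
have -> : \bigcap_(i in [set i | i \in [set: 'I_n]%SET])
      ((Y i : T -> nat) @^-1` [set y i]) = [set w | forall l, Y l w = y l].
  apply/seteqP; split=> [w Yw l|w Yw l _]; last exact: Yw.
  by apply: Yw; rewrite /= inE.
rewrite (eq_bigr (fun l => (((a *m xstar) l 0) ^+ y l / (y l)`!%:R *
    expR (- (a *m xstar) l 0))%:E)); last first.
  move=> l _; rewrite -poisson_prob_set1//.
  exact: (obs_poisson model Pa0 l [set y l]).
rewrite prodEFin /cond_prob setIC => -[].
under eq_bigl do rewrite inE.
set c := fine (P [set w | design_mx A w = a]) => cE.
have c0 : c != 0.
  rewrite /c fine_eq0// fin_num_measure//.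
  exact: (measurable_model_event A Y (fun a' _ => a' = a)).
rewrite -cE mulrC divfK// fineK// fin_num_measure//.
apply: measurableI; last exact: (measurable_obs Y y).
exact: (measurable_model_event A Y (fun a' _ => a' = a)).
Qed.

(** On the counts smaller than [N] this is Bernstein's bound over finitely many
outcomes; the bound does not depend on [N], and continuity from below concludes. *)
Lemma conditional_obs_tail (a : 'M[R]_(n, p)) (g : 'I_n -> R) (b V u : R) :
  (forall l, 0 <= (a *m xstar) l 0) -> (forall l, `|g l| <= b) -> 0 < b ->
  \sum_l g l ^+ 2 * (a *m xstar) l 0 <= V -> 0 <= u ->
  (P ([set w | design_mx A w = a] `&`
      [set w | bernstein_radius V b u <=
               \sum_l g l * ((Y l w)%:R - (a *m xstar) l 0)]%R) <=
   P [set w | design_mx A w = a] * (expR (- u))%:E)%E.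
Proof.
move=> lam0 gb b0 gV u0; set lam := fun l => (a *m xstar) l 0 in lam0 gV *.
set F := [set w | design_mx A w = a].
have mF : measurable F.
  exact: (measurable_model_event A Y (fun a' _ => a' = a)).
set E := F `&` _.
have mE : measurable E.
  have -> : E = [set w | design_mx A w = a /\ bernstein_radius V b u <=
      \sum_l g l * (obs_vec Y w l 0 - lam l)].
    have sumE w : \sum_l g l * (obs_vec Y w l 0 - lam l) =
        \sum_l g l * ((Y l w)%:R - lam l).
      by apply: eq_bigr => l _; rewrite mxE.
    by apply/seteqP; split=> w /=; rewrite sumE.
  exact: (measurable_model_event A Y (fun a' y => a' = a /\
    bernstein_radius V b u <= \sum_l g l * (y l 0 - lam l))).
have [F0|F0] := eqVneq (P F) 0%E.
  rewrite F0 mul0e -F0 le_measure ?inE//; exact: subIsetl.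
have V0 : 0 <= V.
  apply: le_trans gV; apply: sumr_ge0 => l _.
  by rewrite mulr_ge0 ?sqr_ge0//; exact: lam0.
(* the truncation level [N] is uniform in [l], so that [EN] exhausts [E] *)
pose EN N := E `&` [set w | forall l, (Y l w < N)%N].
have mEN N : measurable (EN N).
  apply: measurableI => //.
  by apply: (@measurable_forall_fin _ _ _ (fun l => Y l @^-1` [set m | (m < N)%N]))
    => l; exact: measurable_funPTI.
have ENE : \bigcup_N EN N = E.
  apply/seteqP; split=> [w [N _ []]//|w Ew].
  exists (\max_l Y l w).+1 => //; split=> // l.
  by rewrite /= ltnS leq_bigmax.
have EN_le N : (P (EN N) <= (fine (P F) * expR (- u))%:E)%E.
  apply: (@bernstein_grid _ _ _ P 'I_n 'I_N nat (fun l => Y l) val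
    (fun l m => g l * (m%:R - lam l))
    (fun l k => lam l ^+ k / k`!%:R * expR (- lam l)) F (EN N) (fine (P F)) V b u
    (fun l => g l ^+ 2 * lam l)) => //.
  - move=> y; apply: measurableI => //.
    exact: (measurable_obs Y (fun l => val (y l))).
  - move=> y; have := conditional_obs_law (fun l => val (y l)) lam0 F0.
    by move=> /= ->.
  - by rewrite fine_ge0.
  - by move=> l k; rewrite mulr_ge0 ?expR_ge0// divr_ge0// exprn_ge0//; exact: lam0.
  - by move=> theta theta0 thetab l; apply: poisson_mgf => //; exact: lam0.
  - move=> w [[Fw Dw] Yw]; split=> // l.
    by exists (Ordinal (Yw l)).
have ndEN : nondecreasing_seq EN.
  move=> N N' NN'; apply/subsetPset => w [Ew Yw]; split=> // l.
  exact: leq_trans (Yw l) NN'.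
have := nondecreasing_cvg_mu (mu := P) mEN _ ndEN.
rewrite ENE => /(_ mE) cvgE.
rewrite -(fineK (fin_num_measure P _ mF)) -EFinM -(cvg_lim _ cvgE)//.
apply: lime_le; first by apply/cvg_ex; exists (P E).
exact: nearW.
Qed.

End deviations.

Section unconditional.
Context {d : measure_display} {T : measurableType d} {R : realType}.
Context (P : probability T R) (n p : nat) (q : R) (xstar : 'cV[R]_p).
Context (A : 'I_n -> 'I_p -> {RV P >-> bool}) (Y : 'I_n -> {RV P >-> nat}).
Hypothesis xstar_ge0 : forall k, 0 <= xstar k 0.
Hypothesis model : bernoulli_poisson_model q xstar A Y.

(** Coefficients and variance proxy may depend on the design, since the bound is
applied on each fiber of the design; the hypotheses range over the values that the
design can take. *)
Lemma obs_tail (g : 'M[R]_(n, p) -> 'I_n -> R) (V : 'M[R]_(n, p) -> R) (b u : R) :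
  (forall m : 'M[bool]_(n, p), let a := map_mx (fun c : bool => c%:R) m in
     (forall l, `|g a l| <= b) /\
     \sum_l g a l ^+ 2 * (a *m xstar) l 0 <= V a) ->
  0 < b -> 0 <= u ->
  (P [set w | bernstein_radius (V (design_mx A w)) b u <=
              \sum_l g (design_mx A w) l *
                     (obs_vec Y w l 0 - (design_mx A w *m xstar) l 0)]%R <=
   (expR (- u))%:E)%E.
Proof.
move=> gV b0 u0.
apply: (@le_measure_of_fibers _ _ _ P 'M[bool]_(n, p) (bool_mx A)).
- exact: measurable_bool_mx.
- exact: (measurable_model_event A Y (fun a y => bernstein_radius (V a) b u <=
    \sum_l g a l * (y l 0 - (a *m xstar) l 0))).
move=> m; have [] := gV m; set a := map_mx _ m => ga Va.
have lam0 l : 0 <= (a *m xstar) l 0.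
  by rewrite mxE; apply: sumr_ge0 => k _; rewrite mulr_ge0// mxE; case: (m l k).
have aE : bool_mx A @^-1` [set m] = [set w | design_mx A w = a].
  apply/seteqP; split=> w /=; rewrite design_mxE; first by move=> ->.
  move=> /matrixP aE.
  apply/matrixP => l k; have := aE l k; rewrite !mxE.
  by case: (A l k w); case: (m l k) => //= /eqP; rewrite ?oner_eq0// eq_sym
    oner_eq0.
have := conditional_obs_tail model lam0 ga b0 Va u0; rewrite aE.
apply: le_trans; rewrite [X in P X](_ : _ = [set w | design_mx A w = a] `&`
  [set w | bernstein_radius (V a) b u <=
   \sum_l g a l * ((Y l w)%:R - (a *m xstar) l 0)])//.
have sumE w : \sum_l g a l * (obs_vec Y w l 0 - (a *m xstar) l 0) =
    \sum_l g a l * ((Y l w)%:R - (a *m xstar) l 0).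
  by apply: eq_bigr => l _; rewrite mxE.
by apply/seteqP; split=> w /= [wa]; rewrite wa sumE.
Qed.

End unconditional.

Section deterministic.
Context {R : realType}.

(** The hypothesis is a quadratic inequality in [sqrt v]: with [t = sqrt (b u / 2)] it
reads [(sqrt v - t) ^+ 2 <= t ^+ 2 + b u / 3 + w].  It turns a lower deviation of an
estimator [w] of [v] into an upper bound on [v] by observable quantities. *)
Lemma sqrt_intensity_le (v w b u : R) :
  0 <= v -> 0 <= w -> 0 <= b -> 0 <= u ->
  v - w <= bernstein_radius (b * v) b u ->
  Num.sqrt v <= Num.sqrt (b * u / 2) + Num.sqrt (5 * (b * u) / 6 + w).
Proof.
move=> v0 w0 b0 u0.
have bu0 : 0 <= b * u by exact: mulr_ge0.
rewrite /bernstein_radius.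
have -> : Num.sqrt (2 * (b * v) * u) = 2 * Num.sqrt v * Num.sqrt (b * u / 2).
  have -> : 2 * (b * v) * u = 2 ^+ 2 * v * (b * u / 2) by field.
  rewrite sqrtrM ?mulr_ge0// [in LHS]sqrtrM ?exprn_ge0//.
  by rewrite sqrtr_sqr ger0_norm.
have := sqr_sqrtr v0; have := sqrtr_ge0 v.
have h0 : 0 <= b * u / 2 by rewrite divr_ge0.
have := sqr_sqrtr h0; have := sqrtr_ge0 (b * u / 2).
set s := Num.sqrt v; set t := Num.sqrt (b * u / 2) => t0 tE s0 sE H.
rewrite -lerBlDl; have [st|st] := leP (s - t) 0.
  by rewrite (le_trans st)// sqrtr_ge0.
rewrite -[leLHS](ger0_norm (ltW st)) -sqrtr_sqr ler_wsqrtr//.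
nra.
Qed.

Context (n p : nat) (q : R) (xstar : 'cV[R]_p).
Implicit Types (a : 'M[R]_(n, p)) (y : 'cV[R]_n).

(** Coefficient of the observation [l] in the [k]-th coordinate of [tildeA^T tildeY]. *)
Definition contrast a k l : R :=
  (n%:R * a l k - \sum_l' a l' k) / (n%:R * (n%:R - 1) * q * (1 - q)).

(** Coefficient of [xstar j] in the [k]-th coordinate of the estimating equation, once
the observations have been centred at their conditional means. *)
Definition cross_deviation a k j : R :=
  (\sum_l (a l k - q) * (a l j - q) -
   column_deviation q a k * column_deviation q a j) /
  ((n%:R - 1) * (n%:R * (q * (1 - q)))).

Hypothesis n2 : (2 <= n)%N.
Hypothesis q01 : 0 < q < 1.

Let n0 : 0 < n%:R :> R. Proof. by rewrite ltr0n (leq_trans _ n2). Qed.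
Let n1 : 0 < n%:R - 1 :> R. Proof. by rewrite subr_gt0 ltr1n. Qed.
Let q0 : 0 < q. Proof. by case/andP: q01. Qed.
Let q1 : 0 < 1 - q. Proof. by case/andP: q01; lra. Qed.

Lemma tildeAE a l k :
  tildeA q a l k = (Num.sqrt (n%:R * q * (1 - q)))^-1 * (a l k - q).
Proof. by rewrite !mxE big_ord1 !mxE !mulr1. Qed.

Lemma contrastE a k l : contrast a k l =
  (n%:R * (a l k - q) - column_deviation q a k) /
  ((n%:R - 1) * (n%:R * (q * (1 - q)))).
Proof.
rewrite /contrast /column_deviation sumrB sumr_const card_ord -[q *+ n]mulr_natl.
by field; rewrite !gt_eqF.
Qed.

Lemma sum_contrast a k : \sum_l contrast a k l = 0.
Proof.
rewrite /contrast -mulr_suml sumrB -mulr_sumr sumr_const card_ord.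
by rewrite -[X in _ - X]mulr_natl subrr mul0r.
Qed.

(** The coefficients [contrast q a k] sum to zero, so the intensities may be centred
by [q] times the sum of [xstar] for free; the coefficients of [xstar] on the two sides
then agree. *)
Lemma estimating_equation_decomposition a y k :
  ((tildeA q a)^T *m (tildeY q y - tildeA q a *m xstar)) k 0 =
  \sum_l contrast a k l * (y l 0 - (a *m xstar) l 0) +
  \sum_j xstar j 0 * cross_deviation a k j.
Proof.
set s := n%:R * (q * (1 - q)).
have s0 : s != 0 by rewrite !mulf_neq0// gt_eqF.
pose al l j := a l j - q.
have sq2 : (Num.sqrt (n%:R * q * (1 - q)))^-1 * (Num.sqrt (n%:R * q * (1 - q)))^-1
    = s^-1.
  by rewrite -invfM -expr2 sqr_sqrtr /s ?mulrA// !mulr_ge0// ltW.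
have N1 : n%:R - 1 != 0 :> R by rewrite gt_eqF.
set sg := (Num.sqrt _)^-1 in sq2.
have lhs l : (tildeA q a)^T k l * (tildeY q y - tildeA q a *m xstar) l 0 =
   contrast a k l * y l 0
   + ((column_deviation q a k * y l 0 - al l k * \sum_l' y l' 0) / ((n%:R - 1) * s))
   - al l k * (\sum_j al l j * xstar j 0) / s.
  have -> : (tildeY q y - tildeA q a *m xstar) l 0 =
      sg / (n%:R - 1) * (n%:R * y l 0 - \sum_l' y l' 0) -
      sg * \sum_j al l j * xstar j 0.
    rewrite 4!mxE [in LHS]mxE !mxE mulr1 invfM [sg / _]mulrC.
    congr (_ - _); rewrite mulr_sumr; apply: eq_bigr => j _.
    by rewrite tildeAE mulrA.
  rewrite mxE tildeAE contrastE -/(al l k) -/s -/sg.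
  move: (\sum_j al l j * _) (\sum_l' _) (column_deviation _ _ _) => z1 z2 z3.
  transitivity (sg * sg * (al l k / (n%:R - 1) * (n%:R * y l 0 - z2) - al l k * z1)).
    by ring.
  by rewrite sq2; field; rewrite s0.
rewrite mxE (eq_bigr _ (fun l _ => lhs l)) sumrB big_split/=.
have -> : \sum_l (column_deviation q a k * y l 0 - al l k * \sum_l' y l' 0) /
    ((n%:R - 1) * s) = 0.
  by rewrite -mulr_suml sumrB -mulr_sumr -mulr_suml subrr mul0r.
rewrite addr0.
under [in RHS]eq_bigr do rewrite mulrBr.
rewrite sumrB -addrA; congr (_ + _).
apply/eqP; rewrite -subr_eq0 opprD opprK; apply/eqP.
have -> : \sum_l contrast a k l * (a *m xstar) l 0 =
    \sum_j xstar j 0 * \sum_l contrast a k l * al l j.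
  under eq_bigr do rewrite mxE mulr_sumr.
  rewrite exchange_big; apply: eq_bigr => j _.
  transitivity (\sum_l xstar j 0 * (contrast a k l * al l j) +
                q * xstar j 0 * \sum_l contrast a k l).
    by rewrite mulr_sumr -big_split; apply: eq_bigr => l _; rewrite /al/=; ring.
  by rewrite sum_contrast mulr0 addr0 mulr_sumr.
have -> : \sum_l al l k * (\sum_j al l j * xstar j 0) / s =
    \sum_j xstar j 0 * ((\sum_l al l k * al l j) / s).
  under eq_bigr do rewrite mulr_sumr mulr_suml.
  rewrite exchange_big; apply: eq_bigr => j _.
  by rewrite mulr_suml mulr_sumr; apply: eq_bigr => l _; ring.
rewrite -sumrB -sumrN -big_split/= big1// => j _.
have -> : \sum_l contrast a k l * al l j =
    (n%:R * \sum_l al l k * al l j -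
     column_deviation q a k * column_deviation q a j) / ((n%:R - 1) * s).
  under eq_bigr do rewrite contrastE mulrAC mulrBl.
  rewrite -mulr_suml sumrB -mulr_sumr [in RHS]mulr_sumr.
  by congr ((_ - _) / _); apply: eq_bigr => l _; rewrite mulrA.
rewrite /cross_deviation -/s.
move: (\sum_l _) (column_deviation _ _ _) (column_deviation _ _ _) => c z1 z2.
by field; rewrite s0.
Qed.

End deterministic.

(** * The estimating equation outside the deviation events *)

Section good_event.
Context {R : realType}.

(** Lower bound used to absorb the terms of [cross_deviation_le] without a factor
[ln p] into those with one. *)
Lemma ln_nat_ge_half (p : nat) : (2 <= p)%N -> 1 / 2 <= ln p%:R :> R.
Proof.
move=> p2; have p0 : 0 < p%:R :> R by rewrite ltr0n (leq_trans _ p2).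
have : ln (p%:R^-1 : R) <= p%:R^-1 - 1.
  by rewrite -[X in ln X](subrKC 1) le_ln1Dx// ltrBrDl addrN invr_gt0.
rewrite lnV ?posrE//.
have : p%:R^-1 <= 2^-1 :> R by rewrite lef_pV2 ?posrE// ler_nat.
lra.
Qed.

Context (n p : nat) (q : R) (xstar : 'cV[R]_p).
Hypothesis n2 : (2 <= n)%N.
Hypothesis p2 : (2 <= p)%N.
Hypothesis q01 : 0 < q < 1.
Hypothesis xstar_ge0 : forall k, 0 <= xstar k 0.
Let L : R := ln p%:R.
Let M : R := Num.max q (1 - q).
Let s : R := q * (1 - q).
Hypothesis nq : 12 * M * L <= n%:R * q.

Let n0 : 0 < n%:R :> R. Proof. by rewrite ltr0n (leq_trans _ n2). Qed.
Let n2R : 2 <= n%:R :> R. Proof. by rewrite ler_nat. Qed.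
Let n1 : 0 < n%:R - 1 :> R. Proof. by rewrite subr_gt0 ltr1n. Qed.
Let q0 : 0 < q. Proof. by case/andP: q01. Qed.
Let q1 : 0 < 1 - q. Proof. by case/andP: q01; lra. Qed.
Let L0 : 1 / 2 <= L. Proof. exact: ln_nat_ge_half. Qed.
Let M0 : 0 < M. Proof. by rewrite lt_max q0. Qed.
Let qM : q <= M. Proof. by rewrite le_max lexx. Qed.
Let qM' : 1 - q <= M. Proof. by rewrite le_max lexx orbT. Qed.
Let s0 : 0 < s. Proof. exact: mulr_gt0. Qed.
Let Lge0 : 0 <= L. Proof. by apply: le_trans L0; rewrite divr_ge0. Qed.

Definition column_radius : R := bernstein_radius (n%:R * (q * (1 - q))) M (3 * L).
Let D := column_radius.

Lemma column_radiusE :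
  column_radius = Num.sqrt (6 * n%:R * q * (1 - q) * L) + M * L.
Proof.
rewrite /column_radius /bernstein_radius; congr (Num.sqrt _ + _); first by ring.
by field.
Qed.

Lemma column_radius_sqr :
  column_radius ^+ 2 <= 12 * (n%:R * s) * L + 2 * (M * L) ^+ 2.
Proof.
rewrite column_radiusE.
have h : 0 <= 6 * n%:R * q * (1 - q) * L.
  by rewrite !mulr_ge0// ltW.
have := sqr_sqrtr h; set t := Num.sqrt _; rewrite /s; move: (M * L) => z tE.
have : 0 <= (t - z) ^+ 2 by exact: sqr_ge0.
nra.
Qed.

(** By [nq], the square root is at most [3 / 4] of [n q] and the linear term at most
[1 / 12] of it, so the denominator of [Nhat] is positive. *)
Lemma column_radius_lt : column_radius < n%:R * q.
Proof.
rewrite column_radiusE.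
(* [nq] gives [6 (n q) ((1 - q) L) <= (n q) ^+ 2 / 2], and [1 / 2 <= 9 / 16] *)
have h : 6 * n%:R * q * (1 - q) * L <= (3 / 4 * (n%:R * q)) ^+ 2.
  have -> : 6 * n%:R * q * (1 - q) * L = 6 * (n%:R * q) * ((1 - q) * L) by ring.
  have : 12 * ((1 - q) * L) <= n%:R * q.
    apply: le_trans nq; rewrite -mulrA ler_pM2l// ler_wpM2r//.
  have : 0 < n%:R * q by exact: mulr_gt0.
  move: (n%:R * q) ((1 - q) * L) => z w *.
  nra.
have z0 : 0 < n%:R * q by exact: mulr_gt0.
have : Num.sqrt (6 * n%:R * q * (1 - q) * L) <= 3 / 4 * (n%:R * q).
  apply: le_trans (ler_wsqrtr h) _.
  by rewrite sqrtr_sqr ger0_norm// mulr_ge0// ltW.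
move: nq; rewrite -mulrA; lra.
Qed.

Variables (a : 'M[R]_(n, p)) (y : 'cV[R]_n).
Hypothesis a_idem : forall l k, a l k ^+ 2 = a l k.

Let a01 l k : 0 <= a l k <= 1.
Proof.
have h := a_idem l k; rewrite -h sqr_ge0/=.
have := sqr_ge0 (a l k - 1); have := sqr_ge0 (a l k); rewrite sqrrB; lra.
Qed.

Hypothesis column_good : forall k, `|column_deviation q a k| <= D.

(** Since [a ^+ 2 = a], the squared norm of a centred column is affine in its sum,
and the cross products are controlled by the squared norms; concentration of the column
sums therefore suffices. *)
Lemma cross_deviation_le k j : `|cross_deviation q a k j| <=
  126 * (3 * L / n%:R + 9 * M ^+ 2 / (n%:R ^+ 2 * q * (1 - q)) * L ^+ 2).
Proof.
have sumsq i : \sum_l (a l i - q) ^+ 2 <= n%:R * s + M * D.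
  have -> : \sum_l (a l i - q) ^+ 2 =
      n%:R * s + (1 - 2 * q) * column_deviation q a i.
    rewrite /column_deviation mulr_sumr -[n in n%:R](card_ord n) mulr_natl.
    rewrite -sumr_const -big_split; apply: eq_bigr => l _ /=.
    by rewrite sqrrB a_idem /s; ring.
  rewrite lerD2l (le_trans (ler_norm _))// normrM ler_pM//.
  have := qM; have := qM'; have := q0; have := q1 => *.
  by rewrite ler_norml; apply/andP; split; lra.
have cross : `|\sum_l (a l k - q) * (a l j - q)| <= n%:R * s + M * D.
  have am l : `|(a l k - q) * (a l j - q)| <=
      2^-1 * ((a l k - q) ^+ 2 + (a l j - q) ^+ 2).
    have := sqr_ge0 (a l k - q - (a l j - q)).
    have := sqr_ge0 (a l k - q + (a l j - q)).
    move: (a l k - q) (a l j - q) => z w; rewrite sqrrB sqrrD ler_norml => *.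
    by apply/andP; split; lra.
  apply: (le_trans (ler_norm_sum _ _ _)); apply: (le_trans (ler_sum _ (fun l _ => am l))).
  rewrite -mulr_sumr big_split/=; have := sumsq k; have := sumsq j.
  by move=> *; lra.
have prd : `|column_deviation q a k * column_deviation q a j| <= D ^+ 2.
  by rewrite normrM expr2 ler_pM.
have den0 : 0 < (n%:R - 1) * (n%:R * s) by rewrite !mulr_gt0.
rewrite /cross_deviation -/s normrM normfV (gtr0_norm den0) ler_pdivrMr//.
apply: (le_trans (ler_normB _ _)); apply: (le_trans (lerD cross prd)).
have -> : 126 * (3 * L / n%:R + 9 * M ^+ 2 / (n%:R ^+ 2 * q * (1 - q)) * L ^+ 2) *
    ((n%:R - 1) * (n%:R * s)) =
    126 * ((n%:R - 1) / n%:R) * (3 * (n%:R * s) * L + 9 * (M * L) ^+ 2).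
  by rewrite /s; field; rewrite !gt_eqF.
have nn : 1 / 2 <= (n%:R - 1) / n%:R :> R.
  by rewrite ler_pdivlMr//; have := n2R; lra.
have DD := column_radius_sqr; rewrite -/D in DD.
have ns0 : 0 < n%:R * s by exact: mulr_gt0.
have nsL : n%:R * s <= 2 * ((n%:R * s) * L).
  by rewrite [leRHS]mulrCA ler_peMr ?(ltW ns0)//; have := L0; lra.
have MML : M <= 2 * (M * L).
  by rewrite [leRHS]mulrCA ler_peMr ?(ltW M0)//; have := L0; lra.
have M2 : M ^+ 2 <= (2 * (M * L)) ^+ 2 by rewrite lerXn2r ?nnegrE ?mulr_ge0// ltW.
have MD : M * D <= (M ^+ 2 + D ^+ 2) / 2.
  by have := sqr_ge0 (M - D); rewrite sqrrB; lra.
have tot0 : 0 <= 3 * (n%:R * s) * L + 9 * (M * L) ^+ 2.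
  by rewrite addr_ge0 ?mulr_ge0 ?sqr_ge0// ltW.
(* [n - 1 >= n / 2] costs the factor 2 between 126 and 63 *)
apply: (@le_trans _ _ (63 * (3 * (n%:R * s) * L + 9 * (M * L) ^+ 2))); last first.
  by rewrite ler_wpM2r//; lra.
have L2 : 0 <= (M * L) ^+ 2 by exact: sqr_ge0.
rewrite [(2 * _) ^+ 2]exprMn in M2.
lra.
Qed.

Let lam l := (a *m xstar) l 0.
Hypothesis y_ge0 : forall l, 0 <= y l 0.

Lemma lam_ge0 l : 0 <= lam l.
Proof.
rewrite /lam mxE; apply: sumr_ge0 => k _; rewrite mulr_ge0//.
by case/andP: (a01 l k).
Qed.

Hypothesis total_good :
  \sum_l -1 * (y l 0 - lam l) <= bernstein_radius (\sum_l lam l) 1 (3 * L).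

(** Each column of the design has at least [n q - D] ones, so the total intensity
dominates [n q - D] times the sum of [xstar]; and the total intensity is estimated
by the total count. *)
Lemma sum_xstar_le_Nhat : \sum_j xstar j 0 <= Nhat p q y.
Proof.
have den0 : 0 < n%:R * q - D by rewrite subr_gt0 column_radius_lt.
rewrite /Nhat -/L -/M -addrA -opprD -column_radiusE -/D mulrC ler_pdivlMr//.
apply: (@le_trans _ _ (\sum_l lam l)).
  rewrite /lam; under [leRHS]eq_bigr do rewrite mxE.
  rewrite exchange_big/= mulr_suml; apply: ler_sum => j _.
  rewrite -mulr_suml mulrC ler_wpM2r//.
  have := column_good j; rewrite ler_norml => /andP[+ _].
  by rewrite /column_deviation sumrB sumr_const card_ord -[q *+ n]mulr_natl; lra.
have lamS : 0 <= \sum_l lam l by apply: sumr_ge0 => l _; exact: lam_ge0.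
have yS : 0 <= \sum_l y l 0 by apply: sumr_ge0.
rewrite -[leLHS](sqr_sqrtr lamS) lerXn2r ?nnegrE ?addr_ge0 ?sqrtr_ge0//.
have := @sqrt_intensity_le _ (\sum_l lam l) (\sum_l y l 0) 1 (3 * L) lamS yS ler01.
rewrite mulr_ge0// !mul1r => /(_ isT).
have -> : 5 * (3 * L) / 6 = 5 * L / 2 by field.
apply; move: total_good; rewrite -mulr_sumr sumrB; lra.
Qed.

Let b := ((n%:R - 1) * q * (1 - q))^-1.
Let b0 : 0 < b. Proof. by rewrite invr_gt0 !mulr_gt0. Qed.
Let V k := \sum_l contrast q a k l ^+ 2 * lam l.

Lemma contrast_le k l : `|contrast q a k l| <= b.
Proof.
have den0 : 0 < n%:R * (n%:R - 1) * q * (1 - q) by rewrite !mulr_gt0.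
rewrite /contrast normrM normfV (gtr0_norm den0) ler_pdivrMr//.
have -> : b * (n%:R * (n%:R - 1) * q * (1 - q)) = n%:R.
  by rewrite /b; field; rewrite !gt_eqF.
have S0 : 0 <= \sum_l' a l' k by apply: sumr_ge0 => i _; case/andP: (a01 i k).
have Sn : \sum_l' a l' k <= n%:R.
  rewrite -[n in n%:R]card_ord -sumr_const; apply: ler_sum => i _.
  by case/andP: (a01 i k).
have : 0 <= n%:R * a l k <= n%:R.
  by case/andP: (a01 l k) => z0 z1; rewrite mulr_ge0 ?ler_piMr// ltW.
by move=> /andP[h1 h2]; rewrite ler_norml; apply/andP; split; lra.
Qed.

Hypothesis obs_good : forall k,
  `|\sum_l contrast q a k l * (y l 0 - lam l)| <= bernstein_radius (V k) b (3 * L).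
Hypothesis variance_good : forall k,
  \sum_l - (contrast q a k l ^+ 2) * (y l 0 - lam l) <=
  bernstein_radius (b ^+ 2 * V k) (b ^+ 2) (3 * L).

(** The three parts of the weight bound respectively the variance term and the linear
term of Bernstein's inequality, and the contribution of the cross deviations. *)
Lemma weights_dominate_of_good : weights_dominate q xstar 126 a y.
Proof.
move=> k; rewrite estimating_equation_decomposition//.
apply: (le_trans (ler_normD _ _)); rewrite /weight -/L; apply: lerD.
  apply: (le_trans (obs_good k)); rewrite /bernstein_radius.
  have -> : b * (3 * L) / 3 = L / ((n%:R - 1) * q * (1 - q)).
    by rewrite /b; field; rewrite !gt_eqF.
  rewrite lerD2r (_ : 2 * V k * (3 * L) = 6 * L * V k); last by ring.
  rewrite sqrtrM ?mulr_ge0// ler_wpM2l ?sqrtr_ge0//.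
  have V0 : 0 <= V k.
    by apply: sumr_ge0 => l _; rewrite mulr_ge0 ?sqr_ge0// lam_ge0.
  have VyE : ((Vvec q a k)^T *m y) 0 0 = \sum_l contrast q a k l ^+ 2 * y l 0.
    by rewrite mxE; apply: eq_bigr => l _; rewrite !mxE.
  rewrite VyE.
  have Vy0 : 0 <= \sum_l contrast q a k l ^+ 2 * y l 0.
    by apply: sumr_ge0 => l _; rewrite mulr_ge0 ?sqr_ge0.
  have := sqrt_intensity_le V0 Vy0 (ltW (exprn_gt0 2 b0)) (mulr_ge0 _ Lge0 : 0 <= 3 * L).
  have -> : b ^+ 2 * (3 * L) / 2 =
      3 * L / (2 * (n%:R - 1) ^+ 2 * q ^+ 2 * (1 - q) ^+ 2).
    by rewrite /b; field; rewrite !gt_eqF.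
  have -> : 5 * (b ^+ 2 * (3 * L)) / 6 =
      5 * L / (2 * (n%:R - 1) ^+ 2 * q ^+ 2 * (1 - q) ^+ 2).
    by rewrite /b; field; rewrite !gt_eqF.
  apply=> //; apply: le_trans (variance_good k).
  rewrite /V -sumrB le_eqVlt; apply/orP; left; apply/eqP.
  by apply: eq_bigr => l _; ring.
have M2E : Num.max (q ^+ 2) ((1 - q) ^+ 2) = M ^+ 2.
  rewrite /M; have [h|h] := leP q (1 - q).
    by apply/max_idPr; rewrite lerXn2r ?nnegrE// ltW.
  by apply/max_idPl; rewrite lerXn2r ?nnegrE// ltW.
rewrite M2E.
apply: (le_trans (ler_norm_sum _ _ _)).
apply: (@le_trans _ _ (\sum_j xstar j 0 *
  (126 * (3 * L / n%:R + 9 * M ^+ 2 / (n%:R ^+ 2 * q * (1 - q)) * L ^+ 2)))).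
  apply: ler_sum => j _; rewrite normrM (ger0_norm (xstar_ge0 j)).
  by rewrite ler_wpM2l// cross_deviation_le.
rewrite -mulr_suml mulrC ler_wpM2l ?sum_xstar_le_Nhat//.
rewrite mulr_ge0// addr_ge0// mulr_ge0 ?sqr_ge0 ?divr_ge0 ?mulr_ge0 ?sqr_ge0//.
all: exact: ltW.
Qed.

End good_event.

(** * Probability of the deviation events *)

Section assembly.
Context {R : realType}.

Lemma failure_mass_lt (p : nat) : (2 <= p)%N ->
  (5 * p%:R + 1) * expR (- (3 * ln p%:R)) < 7 / p%:R :> R.
Proof.
move=> p2; have p0 : 0 < p%:R :> R by rewrite ltr0n (leq_trans _ p2).
have p2R : 2 <= p%:R :> R by rewrite ler_nat.
rewrite expRN expRM_natl lnK ?posrE// ltr_pdivrMr ?exprn_gt0//.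
have -> : 7 / p%:R * p%:R ^+ 3 = 7 * p%:R ^+ 2 :> R.
  by field; rewrite gt_eqF.
nra.
Qed.

Context (n p : nat) (q : R) (xstar : 'cV[R]_p).
Hypothesis n2 : (2 <= n)%N.
Hypothesis p2 : (2 <= p)%N.
Hypothesis q01 : 0 < q < 1.
Hypothesis xstar_ge0 : forall k, 0 <= xstar k 0.
Hypothesis nq : 12 * Num.max q (1 - q) * ln p%:R <= n%:R * q.

Let u : R := 3 * ln p%:R.
Let b : R := ((n%:R - 1) * q * (1 - q))^-1.
Let lam (a : 'M[R]_(n, p)) l := (a *m xstar) l 0.
Let V k a := \sum_l contrast q a k l ^+ 2 * lam a l.

(** Signs are booleans.  The left summand indexes the two tails of a column sum; on
the right, [Some (k, Some e)] the two tails of the weighted Poisson sum of coordinate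
[k], [Some (k, None)] the lower tail of its estimated variance, and [None] the lower
tail of the total count. *)
Definition bad_index := ('I_p * bool + option ('I_p * option bool))%type.

Definition bad_event (j : bad_index) (a : 'M[R]_(n, p)) (y : 'cV[R]_n) : Prop :=
  match j with
  | inl (k, e) => bernstein_radius (n%:R * (q * (1 - q))) (Num.max q (1 - q)) u
      <= (-1) ^+ e * column_deviation q a k
  | inr (Some (k, Some e)) => bernstein_radius (V k a) b u
      <= \sum_l (-1) ^+ e * contrast q a k l * (y l 0 - lam a l)
  | inr (Some (k, None)) => bernstein_radius (b ^+ 2 * V k a) (b ^+ 2) u
      <= \sum_l - (contrast q a k l ^+ 2) * (y l 0 - lam a l)
  | inr None => bernstein_radius (\sum_l lam a l) 1 u
      <= \sum_l -1 * (y l 0 - lam a l)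
  end.

Lemma abs_le_of_signs (x r : R) :
  ~ (r <= (-1) ^+ false * x) -> ~ (r <= (-1) ^+ true * x) -> `|x| <= r.
Proof.
rewrite expr0 expr1 mul1r mulN1r => /negP; rewrite -ltNge => xr /negP.
by rewrite -ltNge ler_norml ltrNl => rx; rewrite !ltW.
Qed.

Lemma weights_dominate_of_not_bad (a : 'M[R]_(n, p)) (y : 'cV[R]_n) :
  (forall l k, a l k ^+ 2 = a l k) ->
  (forall l, 0 <= y l 0) -> (forall j, ~ bad_event j a y) ->
  weights_dominate q xstar 126 a y.
Proof.
move=> aid y0 nbad; apply: weights_dominate_of_good => //.
- move=> k; apply: abs_le_of_signs.
    exact: (nbad (inl (k, false))).
  exact: (nbad (inl (k, true))).
- by have /negP := nbad (inr None); rewrite -ltNge => /ltW.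
- move=> k; apply: abs_le_of_signs.
    have := nbad (inr (Some (k, Some false))); rewrite /= mulr_sumr.
    by under eq_bigr do rewrite -mulrA.
  have := nbad (inr (Some (k, Some true))); rewrite /= mulr_sumr.
  by under eq_bigr do rewrite -mulrA.
- by move=> k; have /negP := nbad (inr (Some (k, None))); rewrite -ltNge => /ltW.
Qed.

Context {d : measure_display} {T : measurableType d} (P : probability T R).
Context (A : 'I_n -> 'I_p -> {RV P >-> bool}) (Y : 'I_n -> {RV P >-> nat}).
Hypothesis model : bernoulli_poisson_model q xstar A Y.

Lemma bad_event_tail j :
  (P [set w | bad_event j (design_mx A w) (obs_vec Y w)] <= (expR (- u))%:E)%E.
Proof.
have u0 : 0 <= u by rewrite mulr_ge0// ln_ge0// ler1n (leq_trans _ p2).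
have b0 : 0 < b.
  rewrite invr_gt0; case/andP: q01 => q0 q1.
  by rewrite !mulr_gt0// ?subr_gt0// ltr1n.
have idem (m : 'M[bool]_(n, p)) l k :
    (map_mx (fun c : bool => c%:R) m : 'M[R]_(n, p)) l k ^+ 2 =
    (map_mx (fun c : bool => c%:R) m : 'M[R]_(n, p)) l k.
  by rewrite mxE; case: (m l k); rewrite ?expr1n ?expr0n.
have lam0 (m : 'M[bool]_(n, p)) l : 0 <= lam (map_mx (fun c : bool => c%:R) m) l.
  exact: (lam_ge0 xstar_ge0 (idem m)).
case: j => [[k e]|[[k [e|]]|]] /=.
- by apply: (column_deviation_tail q01 model) => //; rewrite normr_sign.
- apply: (obs_tail xstar_ge0 model (g := fun a l => (-1) ^+ e * contrast q a k l)
    (V := V k)) => // m a; split=> [l|].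
    rewrite normrMsign.
    exact: (contrast_le n2 q01 (idem m) k l).
  rewrite le_eqVlt; apply/orP; left; apply/eqP; apply: eq_bigr => l _.
  by rewrite exprMn sqrr_sign mul1r.
- apply: (obs_tail xstar_ge0 model (g := fun a l => - (contrast q a k l ^+ 2))
    (V := fun a => b ^+ 2 * V k a)) => //; last exact: exprn_gt0.
  move=> m a; have ca l : contrast q a k l ^+ 2 <= b ^+ 2.
    rewrite -(real_normK (num_real (contrast q a k l))).
    rewrite lerXn2r ?nnegrE ?(ltW b0)//.
    exact: (contrast_le n2 q01 (idem m) k l).
  split=> [l|]; first by rewrite normrN ger0_norm ?sqr_ge0.
  rewrite /V mulr_sumr; apply: ler_sum => l _.
  rewrite sqrrN expr2 -mulrA ler_wpM2r// mulr_ge0 ?sqr_ge0//; exact: lam0.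
- apply: (obs_tail xstar_ge0 model (g := fun _ _ => -1)
    (V := fun a => \sum_l lam a l)) => // m a; split=> [l|].
    by rewrite normrN1.
  by under eq_bigr do rewrite sqrrN expr1n mul1r.
Qed.

Lemma weights_dominate_probability :
  (P [set w | weights_dominate q xstar 126 (design_mx A w) (obs_vec Y w)]
     > (1 - 7 / p%:R)%:E)%E.
Proof.
have mG := measurable_model_event A Y (fun a y => weights_dominate q xstar 126 a y).
have mB j := measurable_model_event A Y (bad_event j).
apply: lt_le_trans (union_bound_compl mG mB bad_event_tail _).
  rewrite lte_fin ltrD2l ltrN2 (le_lt_trans _ (failure_mass_lt p2))//.
  rewrite ler_wpM2r ?expR_ge0// card_sum card_option !card_prod.
  rewrite card_option card_bool card_ord -[(p * 3).+1]addn1 !natrD !natrM; lra.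
move=> w nbad; apply: weights_dominate_of_not_bad => //.
- by move=> l k; rewrite mxE; case: (A l k w); rewrite ?expr1n ?expr0n.
- by move=> l; rewrite mxE.
Qed.

End assembly.

Theorem proposition8 (R : realType) :
  exists c c' : R, 0 < c /\ 0 < c' /\
  forall (n p : nat) (q : R) (xstar : 'cV[R]_p),
    (2 <= n)%N -> (2 <= p)%N -> 0 < q < 1 ->
    n%:R * q >= 12 * Num.max q (1 - q) * ln p%:R ->
    (forall k, 0 <= xstar k 0) ->
  forall (d : measure_display) (T : measurableType d) (P : probability T R)
    (A : 'I_n -> 'I_p -> {RV P >-> bool}) (Y : 'I_n -> {RV P >-> nat}),
    bernoulli_poisson_model q xstar A Y ->
    (P [set w | weights_dominate q xstar c (design_mx A w) (obs_vec Y w)]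
       > (1 - c' / p%:R)%:E)%E /\
    ((20 <= n)%N ->
     (P [set w | weights_dominate q xstar 126 (design_mx A w) (obs_vec Y w)]
       > (1 - c' / p%:R)%:E)%E).
Proof.
exists 126, 7; do 2![split; first by []].
move=> n p q xstar n2 p2 q01 nq x0 d T P A Y model.
by have H := weights_dominate_probability n2 p2 q01 x0 nq model; split.
Qed.
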